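(* For any $\delta\in(1,2]$ there is a dual Banach space (that is, a real Banach space isometrically isomorphic to the dual of some Banach space) which is $\delta$-average rough and is not $\gamma$-average rough for any $\gamma>\delta$.
   Context: For a Banach space $X$, $S_X$ denotes its unit sphere. For $\delta>0$, a Banach space $X$ is $\delta$-average rough if, whenever $n\in\mathbb{N}$ ($n\ge 1$) and $x_1,\dots,x_n\in S_X$, $$\limsup_{\|y\|\to 0}\frac1n\sum_{i=1}^n\frac{\|x_i+y\|+\|x_i-y\|-2}{\|y\|}\geq\delta,$$ where $y$ ranges over nonzero elements of $X$. *)

(* Defs.v *)
From HB Require Import structures.
From mathcomp Require Import all_boot all_order all_algebra.
From mathcomp Require Import all_classical all_reals all_analysis.
Set Implicit Arguments.
Unset Strict Implicit.
Unset Printing Implicit Defensive.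
Import Order.TTheory GRing.Theory Num.Theory.
Import numFieldNormedType.Exports.
Local Open Scope classical_set_scope.
Local Open Scope ring_scope.

Definition unit_sphere (R : realType) (X : normedModType R) : set X :=
  [set x | `|x| = 1].

Definition roughness_quotient (R : realType) (X : normedModType R)
    (n : nat) (x : 'I_n -> X) (y : X) : R :=
  n%:R^-1 * \sum_(i < n) ((`|x i + y| + `|x i - y| - 2) / `|y|).

(* 0^' is the punctured neighbourhood filter of 0, so y ranges over nonzero
   vectors and the value of the quotient at y = 0 is irrelevant. *)
Definition average_rough (R : realType) (delta : R) (X : normedModType R)
    : Prop :=
  forall (n : nat) (x : 'I_n -> X), (0 < n)%N ->
    (forall i, unit_sphere (x i)) ->
    (delta%:E <=
      limf_esup (fun y : X => (roughness_quotient x y)%:E) (0%R : X)^')%E.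

Definition topological_dual (R : realType) (Y : normedModType R)
    : set (Y -> R^o) :=
  [set f | linear f /\ continuous f].
Arguments topological_dual {R} Y _.

(* [sup] is 0 on sets that are not bounded above, so this is the dual norm
   only for f in [topological_dual Y]. *)
Definition dual_norm (R : realType) (Y : normedModType R) (f : Y -> R^o) : R :=
  sup [set `|f y| | y in [set y : Y | `|y| <= 1]].

(* The isometric isomorphism from X onto the dual of Y is a linear map into the
   vector space of all functions Y -> R whose range is the dual of Y;
   injectivity follows from preservation of the norm. *)
Definition isometric_to_dual_of (R : realType) (X Y : normedModType R)
    : Prop :=
  exists T : {linear X -> (Y -> R^o)},
    range T = topological_dual Y /\ forall x : X, dual_norm (T x) = `|x|.

Definition is_dual_space (R : realType) (X : normedModType R) : Prop :=
  exists Y : completeNormedModType R, isometric_to_dual_of X Y.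

(* Main.v *)
Require Import Defs.
From HB Require Import structures.
From mathcomp Require Import all_boot all_order all_algebra.
From mathcomp Require Import all_classical all_reals all_analysis.
From mathcomp Require Import ring lra.
Import Order.TTheory GRing.Theory Num.Theory.
Import numFieldNormedType.Exports.
Local Open Scope classical_set_scope.
Local Open Scope ring_scope.

Set Implicit Arguments.
Unset Strict Implicit.
Unset Printing Implicit Defensive.

(** Put [d = delta - 1], so that [0 < d <= 1].  On the plane consider the norm
    [N (a, b) = max (|a|, |b|, (|a| + |b|) / delta)]; its dual norm is
    [N' (p, q) = max (|p| + d |q|, d |p| + |q|)].  Let [Y] be the space of pairs
    of bounded real sequences with [N'] applied to the two sup norms.  The
    required space is the dual [X] of [Y], in which two copies of the dual of
    l_infinity are glued together by [N].

    [X] is [delta]-average rough because one direction serves all points of a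
    given finite subset of the sphere.  Let [D_k] add the [k]-th entries of the two sequences; its norm is at
    most [2 / delta].  A functional [F] on [Y] tends to 0 along the unit vectors
    ([functional_unit_vec_cvg0]), so for large [k] the [k]-th entries of a vector
    [y] that almost norms [F] can be overwritten at almost no cost.  Writing there
    [+p, +q] or [-p, -q], where [p] and [q] are absolute values of entries of [y]
    with [p + d q] close to 1, keeps [y] in the unit ball and makes [D_k y] at
    least about 1, resp. at most about -1.  Hence [|F + s D_k| + |F - s D_k|] is
    at least about [2 + 2 s], while [|s D_k| <= 2 s / delta]
    ([rough_direction], [dual_average_rough]).

    No better constant is possible because [N] is flat near the two axes.  Take
    as two points of the sphere the functionals reading the first entry of either
    sequence.  A small [H] splits as [H1 + H2] along the two sequences, and adding
    [H] or [-H] to these points lengthens them by at most [|H1|], resp. [|H2|]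
    ([norm_first_entry_add]), whereas [|H1| + |H2| <= delta |H|]
    ([norm_part_functional_sum]).

    Both [Y] and [X] are spaces of functions with a sup norm, closed under a
    suitable uniform convergence, and one completeness proof covers them
    ([sup_space_complete]). *)

(** * Function spaces with a sup norm *)

(** A linear space [funs] of functions on [site], to be normed by the supremum of
    [|f|] over [test].  Evaluation at an arbitrary site is bounded by its
    [weight], and [funs] need only be closed under uniform limits relative to the
    weight.  For a dual space the sites are the vectors, the test sites are those
    of the unit ball, and the weight is the norm. *)
Record sup_family (R : realType) := SupFamily {
  site : Type;
  funs : set (site -> R^o);
  test : set site;
  weight : site -> R;
  test_nonempty : test !=set0;
  funs0 : funs 0;
  funsZD : forall (a : R) f g, funs f -> funs g -> funs (a *: f + g);
  funs_bounded : forall f, funs f -> exists M, forall t, test t -> `|f t| <= M;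
  funs_weight : forall f M, funs f -> (forall t, test t -> `|f t| <= M) ->
    forall t, `|f t| <= weight t * M;
  funs_closed : forall f,
    (forall e, 0 < e ->
      exists2 g, funs g & forall t, `|f t - g t| <= weight t * e) ->
    funs f }.

Definition funs_pred (R : realType) (D : sup_family R) :
  {pred (site D -> R^o)} :=
  [pred f | f \in @funs R D].

Lemma funs_pred_submod_closed (R : realType) (D : sup_family R) :
  submod_closed (@funs_pred R D).
Proof.
split=> [|a f g]; rewrite !inE.
  exact: funs0.
exact: funsZD.
Qed.

HB.instance Definition _ (R : realType) (D : sup_family R) :=
  GRing.isSubmodClosed.Build _ _ (@funs_pred R D) (@funs_pred_submod_closed R D).

Record sup_space (R : realType) (D : sup_family R) :=
  SupElement { fn : site D -> R^o; fnP : fn \in @funs_pred R D }.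

Section sup_space.
Context (R : realType) (D : sup_family R).
Local Notation E := (@sup_space R D).
Implicit Types (x y : E) (t : site D).

HB.instance Definition _ := [isSub for @fn R D].
HB.instance Definition _ := [Choice of E by <:].
HB.instance Definition _ := [SubChoice_isSubLmodule of E by <:].

Lemma fn_funs x : @funs R D (fn x).
Proof. by have := fnP x; rewrite inE. Qed.

Lemma funs_pred_intro f : @funs R D f -> f \in @funs_pred R D.
Proof. by rewrite inE. Qed.

Lemma fnD x y t : fn (x + y) t = fn x t + fn y t.
Proof. by []. Qed.

Lemma fnZ (a : R) x t : fn (a *: x) t = a * fn x t.
Proof. by []. Qed.

Lemma fnN x t : fn (- x) t = - fn x t.
Proof. by []. Qed.

Definition supnorm x : R := sup [set `|fn x t| | t in @test R D].

Lemma fn_le_supnorm x t : test t -> `|fn x t| <= supnorm x.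
Proof.
move=> Dt; apply: ub_le_sup; last by exists t.
have [M HM] := funs_bounded (fn_funs x).
by exists M => _ [s Ds <-]; exact: HM.
Qed.

Lemma supnorm_le x (M : R) :
  (forall t, test t -> `|fn x t| <= M) -> supnorm x <= M.
Proof.
move=> xM; apply: ge_sup.
  by have [t Dt] := @test_nonempty R D; exists `|fn x t|; exists t.
by move=> _ [t Dt <-]; exact: xM.
Qed.

Lemma fn_le_weight x t : `|fn x t| <= weight t * supnorm x.
Proof.
by apply: funs_weight; [exact: fn_funs|move=> s; exact: fn_le_supnorm].
Qed.

Lemma weight_ge0 t : 0 <= @weight R D t.
Proof.
rewrite -[weight t]mulr1; apply: le_trans (normr_ge0 ((0 : site D -> R^o) t)) _.
by apply: (funs_weight (funs0 D)) => s _; rewrite normr0.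
Qed.

Lemma supnormD x y : supnorm (x + y) <= supnorm x + supnorm y.
Proof.
apply: supnorm_le => t Dt; rewrite fnD (le_trans (ler_normD _ _))//.
by rewrite lerD// fn_le_supnorm.
Qed.

Lemma supnorm_ge0 x : 0 <= supnorm x.
Proof.
have [t Dt] := @test_nonempty R D.
exact: le_trans (normr_ge0 _) (fn_le_supnorm x Dt).
Qed.

Lemma supnormZ (a : R) x : supnorm (a *: x) = `|a| * supnorm x.
Proof.
have le (b : R) z : supnorm (b *: z) <= `|b| * supnorm z.
  apply: supnorm_le => t Dt; rewrite fnZ normrM.
  by rewrite ler_wpM2l// fn_le_supnorm.
apply/eqP; rewrite eq_le le/=; have [->|a0] := eqVneq a 0.
  by rewrite normr0 mul0r supnorm_ge0.
rewrite -[x in leLHS](scalerK a0) -ler_pdivlMl ?normr_gt0// -normfV.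
exact: le.
Qed.

Lemma supnorm0_eq0 x : supnorm x = 0 -> x = 0.
Proof.
move=> x0; apply: val_inj; apply/funext => t /=.
by apply/eqP; rewrite -normr_le0 (le_trans (fn_le_weight x t))// x0 mulr0.
Qed.

HB.instance Definition _ :=
  Lmodule_isNormed.Build R E supnormD supnormZ supnorm0_eq0.

Lemma norm_leP x (M : R) : `|x| <= M <-> forall t, test t -> `|fn x t| <= M.
Proof.
split=> [xM t Dt|]; last exact: supnorm_le.
exact: le_trans (fn_le_supnorm x Dt) xM.
Qed.

Lemma fn_le x t : `|fn x t| <= weight t * `|x|.
Proof. exact: fn_le_weight. Qed.

(** A Cauchy filter converges at every site, at a speed governed by the weight, so
    the pointwise limit is again in the space.  At test sites the speed is uniform,
    which is convergence in norm. *)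
Lemma sup_space_complete (F : set_system E) :
  ProperFilter F -> cauchy F -> cvg F.
Proof.
move=> FF /cauchyP Fc.
have cvgt t : cvg (fn x t @[x --> F]).
  apply: cauchy_cvg; apply/cauchy_exP => e e0.
  have [w0 w_gt0 wle] : exists2 w : R, 0 < w & weight t <= w.
    exists (`|weight t| + 1); first by rewrite ltr_wpDl.
    by rewrite (le_trans (ler_norm _))// lerDl.
  have [x Fx] := Fc (e / w0) (divr_gt0 e0 w_gt0).
  exists (fn x t); change (F [set y | ball (fn x t) e (fn y t)]).
  apply: filterS Fx => y.
  rewrite -!ball_normE /= => xy.
  apply: le_lt_trans (fn_le (x - y) t) _.
  rewrite (@le_lt_trans _ _ (w0 * `|x - y|))// ?ler_wpM2r//.
  by rewrite mulrC -ltr_pdivlMr.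
pose l t : R^o := lim (fn x t @[x --> F]).
(* Used with the weight of [t] to show that [l] is in the space, and with
   [c = 1] at test sites to estimate norms. *)
have lx c t (e : R) x : 0 <= c -> (forall z : E, `|fn z t| <= c * `|z|) ->
    F (ball x e) -> `|l t - fn x t| <= c * e.
  move=> c0 tc Fx.
  have lc : `|fn y t - fn x t| @[y --> F] --> `|l t - fn x t|.
    by apply: cvg_norm; apply: cvgB; [exact: cvgt|exact: cvg_cst].
  rewrite -(cvg_lim _ lc)//; apply: limr_le; first exact: cvgP lc.
  apply: filterS Fx => y; rewrite -ball_normE /= => xy.
  apply: le_trans (tc (y - x)) _.
  by rewrite distrC ler_wpM2l// ltW.
have lmem : funs l.
  apply: funs_closed => e e0; have [x Fx] := Fc e e0.
  exists (fn x); first exact: fn_funs.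
  by move=> t; apply: lx Fx; [exact: weight_ge0|move=> z; exact: fn_le].
pose L := SupElement (funs_pred_intro lmem).
apply/cvg_ex; exists L; apply/cvgrPdist_le => /= e e0.
have e20 : 0 < e / 2 by rewrite divr_gt0.
have [x Fx] := Fc _ e20.
have Lx : `|L - x| <= e / 2.
  apply/norm_leP => t Dt; rewrite -[e / 2]mul1r.
  by apply: lx Fx => // z; rewrite mul1r; apply/norm_leP: t Dt.
apply: filterS Fx => y; rewrite -ball_normE /= => xy.
rewrite -(subrK x L) -addrA (le_trans (ler_normD _ _))//.
by rewrite [e]splitr lerD// ltW.
Qed.

HB.instance Definition _ := Uniform_isComplete.Build E sup_space_complete.

End sup_space.

(** * Dual spaces *)

Section dual.
Context (R : realType) (Y : normedModType R).
Implicit Types (f g : Y -> R^o) (y : Y).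

Lemma topological_dual_intro f (M : R) :
  linear f -> (forall y, `|f y| <= M * `|y|) -> topological_dual Y f.
Proof.
move=> flin fM; split=> //.
pose F : {linear Y -> R^o} := HB.pack f (GRing.isLinear.Build _ _ _ _ f flin).
apply: (bounded_linear_continuous (f := F)); apply/linear_boundedP.
by near=> r => y; rewrite (le_trans (fM y))// ler_wpM2r//; near: r;
  apply: nbhs_pinfty_ge; exact: num_real.
Unshelve. all: by end_near. Qed.

Lemma topological_dual_bounded f : topological_dual Y f ->
  exists M : R, forall y, `|f y| <= M * `|y|.
Proof.
move=> [flin fc].
pose F : {linear Y -> R^o} := HB.pack f (GRing.isLinear.Build _ _ _ _ f flin).
have /linear_bounded_continuous/linear_boundedP/pinfty_ex_gt0[M _ FM] :
  continuous F by exact: fc.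
by exists M.
Qed.

Lemma linear_ball_bound f (M : R) : linear f ->
  (forall y, `|y| <= 1 -> `|f y| <= M) -> forall y, `|f y| <= `|y| * M.
Proof.
move=> flin fM y.
pose F : {linear Y -> R^o} := HB.pack f (GRing.isLinear.Build _ _ _ _ f flin).
have [->|y0] := eqVneq y 0.
  by rewrite (linear0 F : f 0 = 0) !normr0 mul0r.
have ny : 0 < `|y| by rewrite normr_gt0.
rewrite mulrC -ler_pdivrMr// mulrC.
rewrite -[X in X * _](gtr0_norm (x := `|y|^-1)) ?invr_gt0//.
rewrite -normrM -[_ * f y](linearZ_LR F) /=; apply: fM.
by rewrite normrZ gtr0_norm ?invr_gt0// mulVf ?gt_eqF.
Qed.

Lemma topological_dual0 : topological_dual Y 0.
Proof.
apply: (@topological_dual_intro _ 0) => [a x y|y] /=.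
  by rewrite /= scaler0 addr0.
by rewrite normr0 mul0r.
Qed.

Lemma topological_dualZD (a : R) f g : topological_dual Y f ->
  topological_dual Y g -> topological_dual Y (a *: f + g).
Proof.
move=> fd gd; have [M fM] := topological_dual_bounded fd.
have [N gN] := topological_dual_bounded gd.
apply: (@topological_dual_intro _ (`|a| * M + N)) => [b x y|y].
  rewrite !fctE (fd.1 b x y) (gd.1 b x y) /=.
  rewrite !scalerDr !scalerA (mulrC a b) -!addrA; congr (_ + _).
  by rewrite addrCA.
rewrite mulrDl (le_trans (ler_normD _ _))// lerD//.
by rewrite normrZ -mulrA ler_wpM2l.
Qed.

Lemma topological_dual_ball_bounded f : topological_dual Y f ->
  exists M : R, forall y, `|y| <= 1 -> `|f y| <= M.
Proof.
move=> /topological_dual_bounded[M fM]; exists `|M| => y y1.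
rewrite (le_trans (fM y))// (le_trans (ler_norm _))//.
by rewrite normrM normr_id ler_piMr.
Qed.

Lemma topological_dual_closed f :
  (forall e : R, 0 < e -> exists2 g, topological_dual Y g &
    forall y, `|f y - g y| <= `|y| * e) ->
  topological_dual Y f.
Proof.
move=> fcl.
have flin : linear f.
  move=> a x y; apply/eqP; rewrite -subr_eq0 -normr_le0.
  pose K := `|a *: x + y| + `|a| * `|x| + `|y| + 1.
  have K0 : 0 < K by rewrite ltr_wpDl// !addr_ge0// mulr_ge0.
  apply/ler_addgt0Pr => e e0; rewrite add0r.
  have [g gd fg] := fcl (e / K) (divr_gt0 e0 K0).
  have -> : f (a *: x + y) - (a *: f x + f y) =
    (f (a *: x + y) - g (a *: x + y)) - a *: (f x - g x) - (f y - g y).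
    have E (u v w u' v' : R) : w - (a * u + v) =
      (w - (a * u' + v')) - a * (u - u') - (v - v') by ring.
    by rewrite (gd.1 a x y); exact: E.
  rewrite (@le_trans _ _ (K * (e / K)))//; last first.
    by rewrite mulrC divfK// gt_eqF.
  rewrite /K !mulrDl (le_trans (ler_normB _ _))//.
  rewrite -[leLHS]addr0 lerD//; last by rewrite mul1r ltW// divr_gt0.
  rewrite lerD// (le_trans (ler_normB _ _))// lerD// normrZ -mulrA.
  by rewrite ler_wpM2l.
have [g gd fg] := fcl 1 ltr01; have [M gM] := topological_dual_bounded gd.
apply: (@topological_dual_intro _ (1 + M)) => // y.
rewrite -(subrK (g y) (f y)) (le_trans (ler_normD _ _))// mulrDl lerD//.
by rewrite mulrC fg.
Qed.

(** With these choices the norm of the resulting space is [dual_norm] by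
    definition, so that its being a dual space needs no computation. *)
Definition dual_family : sup_family R := {|
  site := Y;
  funs := topological_dual Y;
  test := [set y : Y | `|y| <= 1];
  weight := fun y => `|y|;
  test_nonempty := ex_intro _ (0 : Y)
    (eq_ind_r (fun r : R => r <= 1) ler01 (normr0 Y));
  funs0 := topological_dual0;
  funsZD := topological_dualZD;
  funs_bounded := topological_dual_ball_bounded;
  funs_weight := fun f M fd => @linear_ball_bound f M fd.1;
  funs_closed := topological_dual_closed |}.

End dual.

Lemma dual_is_dual_space (R : realType) (Y : completeNormedModType R) :
  is_dual_space (sup_space (dual_family Y)).
Proof.
exists Y.
have flin : linear (@fn R (dual_family Y)) by move=> a x y.
pose T : {linear sup_space (dual_family Y) -> (Y -> R^o)} :=
  HB.pack (@fn R (dual_family Y)) (GRing.isLinear.Build _ _ _ _ _ flin).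
exists T; split=> //=.
apply/seteqP; split=> [_ [F _ <-]|f fd]; first exact: (fn_funs F).
by exists (SupElement (funs_pred_intro (D := dual_family Y) fd)).
Qed.

(** * Pairs of bounded sequences *)

Section pairs.
Context (R : realType) (d : R) (d0 : 0 < d).
Implicit Types (f : bool * nat * nat * R -> R^o) (w : bool -> nat -> R).

(** A pair of sequences is encoded as one function [w : bool -> nat -> R], the
    boolean naming the sequence.  The functional attached to the site
    [(b, k, l, s)] reads the [k]-th entry of sequence [b] plus [s] times the
    [l]-th entry of the other one; those with [|s| <= d] determine the norm. *)
Definition pair_combination w : bool * nat * nat * R -> R^o :=
  fun t => w t.1.1.1 t.1.1.2 + t.2 * w (~~ t.1.1.1) t.1.2.

(** The sites with [s = 0] read off single entries, hence recover the pair. *)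
Definition pair_funs : set (bool * nat * nat * R -> R^o) :=
  [set f | f = pair_combination (fun b k => f (b, k, 0%N, 0)) /\
    exists M : R, forall t, `|t.2| <= d -> `|f t| <= M].

Lemma pair_funsE f b k l (s : R) : pair_funs f ->
  f (b, k, l, s) = f (b, k, 0%N, 0) + s * f (~~ b, l, 0%N, 0).
Proof. by move=> [fE _]; rewrite {1}fE. Qed.

Lemma pair_combination_funs w (M : R) : (forall b k, `|w b k| <= M) ->
  pair_funs (pair_combination w).
Proof.
move=> wM; split.
  by apply/funext => -[[[b k] l] s]; rewrite /pair_combination/= !mul0r !addr0.
exists (M + d * M) => -[[[b k] l] s] /= sd.
rewrite (le_trans (ler_normD _ _))// lerD// normrM.
by rewrite ler_pM.
Qed.

Lemma pair_funs0 : pair_funs 0.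
Proof.
split; first by apply/funext => t; rewrite /pair_combination /= mulr0 addr0.
by exists 0 => t _; rewrite normr0.
Qed.

Lemma pair_funsZD (a : R) f g : pair_funs f -> pair_funs g ->
  pair_funs (a *: f + g).
Proof.
move=> fP gP; split.
  apply/funext => -[[[b k] l] s]; rewrite /pair_combination /= !fctE.
  rewrite (pair_funsE _ _ _ _ fP) (pair_funsE _ _ _ _ gP).
  have E (u v u' v' : R) : a * (u + s * v) + (u' + s * v') =
    (a * u + u') + s * (a * v + v') by ring.
  exact: E.
have [[_ [M fM]] [_ [N gN]]] := (fP, gP).
exists (`|a| * M + N) => t td; rewrite (le_trans (ler_normD _ _))// lerD ?gN//.
by rewrite normrZ ler_wpM2l// fM.
Qed.

Lemma pair_funs_weight f (M : R) : pair_funs f ->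
  (forall t, `|t.2| <= d -> `|f t| <= M) ->
  forall t, `|f t| <= (1 + `|t.2|) * M.
Proof.
move=> fP fM [[[b k] l] s]; rewrite (pair_funsE _ _ _ _ fP) /=.
rewrite (le_trans (ler_normD _ _))// mulrDl mul1r lerD//.
  by rewrite fM//= normr0 ltW.
by rewrite normrM ler_wpM2l// fM//= normr0 ltW.
Qed.

Lemma pair_funs_closed f :
  (forall e : R, 0 < e -> exists2 g, pair_funs g &
    forall t, `|f t - g t| <= (1 + `|t.2|) * e) ->
  pair_funs f.
Proof.
move=> fcl; split.
  apply/funext => -[[[b k] l] s]; rewrite /pair_combination /=.
  apply/eqP; rewrite -subr_eq0 -normr_le0; apply/ler_addgt0Pr => e e0.
  rewrite add0r; pose K := 2 * (1 + `|s|).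
  have K0 : 0 < K by rewrite mulr_gt0// ltr_wpDr.
  have [g gP fg] := fcl (e / K) (divr_gt0 e0 K0).
  have := fg (b, k, l, s); have := fg (b, k, 0%N, 0).
  have := fg (~~ b, l, 0%N, 0) => /=; rewrite normr0 addr0 mul1r.
  move=> /(ler_wpM2l (normr_ge0 s)); rewrite -normrM => h1 h2 h3.
  have -> : f (b, k, l, s) - (f (b, k, 0%N, 0) + s * f (~~ b, l, 0%N, 0)) =
     (f (b, k, l, s) - g (b, k, l, s)) - (f (b, k, 0%N, 0) - g (b, k, 0%N, 0))
     - s * (f (~~ b, l, 0%N, 0) - g (~~ b, l, 0%N, 0)).
    by rewrite (pair_funsE b k l s gP); ring.
  rewrite (le_trans (ler_normB _ _))//.
  rewrite (le_trans (lerD (ler_normB _ _) (lexx _)))//.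
  rewrite (le_trans (lerD (lerD h3 h2) h1))//.
  rewrite [leRHS](_ : e = K * (e / K)); last by rewrite mulrC divfK ?gt_eqF.
  have E (p q : R) : (1 + p) * q + q + p * q <= 2 * (1 + p) * q.
    by rewrite le_eqVlt; apply/orP; left; apply/eqP; ring.
  exact: E.
have [g [_ [M gM]] fg] := fcl 1 ltr01.
exists (1 + d + M) => t td.
rewrite -(subrK (g t) (f t)) (le_trans (ler_normD _ _))// lerD ?gM//.
by rewrite (le_trans (fg t))// mulr1 lerD2l.
Qed.

Definition pair_family : sup_family R := {|
  site := bool * nat * nat * R;
  funs := pair_funs;
  test := [set t | `|t.2| <= d];
  weight := fun t => 1 + `|t.2|;
  test_nonempty := ex_intro _ (true, 0%N, 0%N, 0)
    (eq_ind_r (fun r : R => r <= d) (ltW d0) (normr0 R));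
  funs0 := pair_funs0;
  funsZD := pair_funsZD;
  funs_bounded := fun f fP => fP.2;
  funs_weight := pair_funs_weight;
  funs_closed := pair_funs_closed |}.

Local Notation Y := (sup_space pair_family).
Implicit Types (x y : Y).

Definition entry y b k : R := fn y (b, k, 0%N, 0).

Arguments entry : simpl never.

Lemma entryD x y b k : entry (x + y) b k = entry x b k + entry y b k.
Proof. by []. Qed.

Lemma entryZ (a : R) y b k : entry (a *: y) b k = a * entry y b k.
Proof. by []. Qed.

Lemma entry_inj x y : (forall b k, entry x b k = entry y b k) -> x = y.
Proof.
move=> xy; apply: val_inj; apply/funext => -[[[b k] l] s] /=.
rewrite (pair_funsE _ _ _ _ (fn_funs x)) (pair_funsE _ _ _ _ (fn_funs y)).
by congr (_ + _ * _); exact: xy.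
Qed.

(** The supremum over [|s| <= d] is attained at [s = d] or [s = - d]; this turns
    the sup norm into the formula of [pair_norm_leP]. *)
Lemma sign_attains (u v : R) :
  exists2 s, `|s| <= d & `|u| + d * `|v| = `|u + s * v|.
Proof.
have Nd : `|d| = d by rewrite gtr0_norm.
have [u0|u0] := lerP 0 u; have [v0|v0] := lerP 0 v.
- have dv : 0 <= d * v by rewrite pmulr_rge0.
  exists d; first by rewrite Nd.
  by rewrite (ger0_norm u0) (ger0_norm v0) ger0_norm ?addr_ge0.
- have dv : d * v <= 0 by rewrite pmulr_rle0// ltW.
  exists (- d); first by rewrite normrN Nd.
  by rewrite (ger0_norm u0) (ltr0_norm v0) ger0_norm; lra.
- have dv : 0 <= d * v by rewrite pmulr_rge0.
  exists (- d); first by rewrite normrN Nd.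
  by rewrite (ltr0_norm u0) (ger0_norm v0) ler0_norm; lra.
- have dv : d * v <= 0 by rewrite pmulr_rle0// ltW.
  exists d; first by rewrite Nd.
  by rewrite (ltr0_norm u0) (ltr0_norm v0) ler0_norm; lra.
Qed.

Lemma pair_norm_leP y (M : R) : `|y| <= M <->
  forall b k l, `|entry y b k| + d * `|entry y (~~ b) l| <= M.
Proof.
split=> [/norm_leP yM b k l|yM].
  have [s sd ->] := sign_attains (entry y b k) (entry y (~~ b) l).
  rewrite -(pair_funsE b k l s (fn_funs y)).
  by apply: (yM (b, k, l, s)).
apply/norm_leP => -[[[b k] l] s] /= sd.
rewrite (pair_funsE _ _ _ _ (fn_funs y)).
rewrite (le_trans (ler_normD _ _))// normrM (le_trans _ (yM b k l))//.
by rewrite lerD// ler_wpM2r.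
Qed.

Lemma entry_le y b k : `|entry y b k| <= `|y|.
Proof.
have /pair_norm_leP/(_ b k 0%N) := lexx `|y|.
by apply: le_trans; rewrite lerDl mulr_ge0// ltW.
Qed.

(** Total for convenience: unbounded [w] are sent to 0. *)
Definition of_entries w : Y :=
  insubd (0 : Y) (pair_combination w).

Lemma of_entriesE w (M : R) b k : (forall b k, `|w b k| <= M) ->
  entry (of_entries w) b k = w b k.
Proof.
move=> wM; rewrite -[LHS]/(val (of_entries w) (b, k, 0%N, 0)) val_insubd.
rewrite (funs_pred_intro (D := pair_family) (pair_combination_funs wM)).
by rewrite /pair_combination /= mul0r addr0.
Qed.

Definition unit_vec b k : Y :=
  of_entries (fun b' j => ((b' == b) && (j == k))%:R).

Lemma entry_unit_vec b k b' j :
  entry (unit_vec b k) b' j = ((b' == b) && (j == k))%:R.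
Proof.
apply: (of_entriesE (M := 1)) => c i.
by case: (_ && _); rewrite ?normr1 ?normr0.
Qed.

Definition part b y : Y :=
  of_entries (fun b' j => if b' == b then entry y b' j else 0).

Lemma entry_part b y b' j :
  entry (part b y) b' j = if b' == b then entry y b' j else 0.
Proof.
apply: (of_entriesE (M := `|y|)) => c i.
by case: ifP => _; rewrite ?normr0 ?entry_le.
Qed.

Lemma partZD b (a : R) x y : part b (a *: x + y) = a *: part b x + part b y.
Proof.
apply: entry_inj => b' j; rewrite entry_part !entryD !entryZ !entry_part.
by case: ifP; rewrite ?mulr0 ?addr0.
Qed.

Lemma part_split b y : y = part b y + part (~~ b) y.
Proof.
apply: entry_inj => b' j; rewrite entryD !entry_part.
by move: b' b => [] [] /=; rewrite ?addr0 ?add0r.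
Qed.

Lemma part_idem b y : part b (part b y) = part b y.
Proof.
by apply: entry_inj => b' j; rewrite !entry_part; case: (b' == b).
Qed.

(** On a single sequence the norm is the sup norm, since the weight [d] of the other
    sequence is at most 1. *)
Lemma norm_part_leP (d1 : d <= 1) b y (M : R) :
  `|part b y| <= M <-> forall k, `|entry y b k| <= M.
Proof.
split=> [yM k|yM].
  have := entry_le (part b y) b k; rewrite entry_part eqxx.
  by move=> /le_trans; exact.
apply/pair_norm_leP => b' k l; rewrite !entry_part.
have [->|b'b] := eqVneq b' b.
  have -> : (~~ b == b) = false by case: (b).
  by rewrite normr0 mulr0 addr0.
have -> : ~~ b' = b by case: b' b b'b {yM} => [] [].
rewrite eqxx normr0 add0r (le_trans _ (yM l))//.
by rewrite ler_piMl.
Qed.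

Lemma norm_part_sum_le (d1 : d <= 1) b y :
  `|part b y| + d * `|part (~~ b) y| <= `|y|.
Proof.
rewrite -lerBrDr; apply/(norm_part_leP d1) => k.
rewrite lerBrDl -lerBrDr mulrC -ler_pdivlMr//.
apply/(norm_part_leP d1) => l; rewrite ler_pdivlMr// lerBrDr mulrC addrC.
by have /pair_norm_leP := lexx `|y|; exact.
Qed.

End pairs.

Arguments entry {R d d0} y b k : simpl never.

(** * Functionals on a normed space *)

Section dual_functionals.
Context (R : realType) (Y : normedModType R).
Local Notation X := (sup_space (dual_family Y)).
Implicit Types (F G : X) (y : Y).

Definition functional (f : Y -> R^o) (fd : topological_dual Y f) : X :=
  SupElement (funs_pred_intro (D := dual_family Y) fd).

Lemma dual_fnZD F (a : R) x y : fn F (a *: x + y) = a * fn F x + fn F y.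
Proof. exact: (fn_funs F).1. Qed.

Lemma dual_fnD F x y : fn F (x + y) = fn F x + fn F y.
Proof. by rewrite -[x in LHS]scale1r dual_fnZD mul1r. Qed.

Lemma dual_fn0 F : fn F 0 = 0.
Proof. by have := fn_le F 0; rewrite /= normr0 mul0r normr_le0 => /eqP. Qed.

Lemma dual_fnZ F (a : R) y : fn F (a *: y) = a * fn F y.
Proof. by rewrite -[a *: y]addr0 dual_fnZD dual_fn0 addr0. Qed.

Lemma dual_fn_le F y (M : R) : `|y| <= M -> `|fn F y| <= M * `|F|.
Proof. by move=> yM; rewrite (le_trans (fn_le F y))// ler_wpM2r. Qed.

Lemma almost_norming F (e : R) : 0 < e ->
  exists2 y, `|y| <= 1 & `|F| - e < fn F y.
Proof.
move=> e0; apply: contrapT => noy.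
suff : `|F| <= `|F| - e by rewrite lerBrDl gerDr leNgt e0.
apply/norm_leP => y /= y1; rewrite leNgt; apply/negP => Fy.
apply: noy; have [Fy0|Fy0] := lerP 0 (fn F y).
  by exists y; rewrite // -(ger0_norm Fy0).
exists (-1 *: y); first by rewrite normrZ normrN1 mul1r.
by rewrite dual_fnZ mulN1r -(ltr0_norm Fy0).
Qed.

End dual_functionals.

(** * Roughness of the dual of the space of pairs *)

Section roughness.
Context (R : realType) (d : R) (d0 : 0 < d) (d1 : d <= 1).
Local Notation Y := (sup_space (pair_family d0)).
Local Notation X := (sup_space (dual_family Y)).
Implicit Types (F G H : X) (y : Y) (b : bool).

Local Notation unit_vec := (unit_vec d0).

Lemma norm_unit_combination b (s : nat -> R) m :
  (forall k, `|s k| <= 1) -> `|\sum_(k < m) s k *: unit_vec b k| <= 1.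
Proof.
move=> s1; have sumE b' j : entry (\sum_(k < m) s k *: unit_vec b k) b' j =
    if (b' == b) && (j < m)%N then s j else 0.
  elim: m => [|m IH]; first by rewrite big_ord0 ltn0 andbF.
  rewrite big_ord_recr /= entryD IH entryZ entry_unit_vec ltnS.
  case: (b' == b); last by rewrite mulr0 addr0.
  by case: ltngtP => [_|_|->]; rewrite ?mulr0 ?mulr1 ?addr0 ?add0r.
apply/pair_norm_leP => b' k l; rewrite !sumE.
have sle (c : bool) j : `|if c then s j else 0| <= 1.
  by case: c; rewrite ?normr0.
have [->|b'b] /= := eqVneq b' b.
  have -> : (~~ b == b) = false by case: (b).
  by rewrite /= normr0 mulr0 addr0 sle.
rewrite normr0 add0r; apply: le_trans (sle ((~~ b' == b) && (l < m)%N) l).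
by rewrite ler_piMl.
Qed.

Lemma norm_unit_vec b k : `|unit_vec b k| <= 1.
Proof.
apply/pair_norm_leP => b' i l; rewrite !entry_unit_vec.
by case: b' b => [] [] /=; case: (i == k); case: (l == k);
  rewrite ?normr0 ?normr1; move: d0 d1; lra.
Qed.

(** The values are absolutely summable: the partial sums are values of [F] at
    combinations of unit vectors with coefficients of modulus at most 1. *)
Lemma functional_unit_vec_cvg0 F b :
  fn F (unit_vec b k) @[k --> \oo] --> (0 : R).
Proof.
apply/norm_cvg0P/cvg_series_cvg_0; apply: nondecreasing_is_cvgn.
  by apply: nondecreasing_series => k _ _; exact: normr_ge0.
exists `|F| => _ [m _ <-]; rewrite /series /= big_mkord.
have -> : \sum_(k < m) `|fn F (unit_vec b k)| =
    fn F (\sum_(k < m) Num.sg (fn F (unit_vec b k)) *: unit_vec b k).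
  elim: m => [|m IH]; first by rewrite !big_ord0 dual_fn0.
  by rewrite !big_ord_recr /= dual_fnD dual_fnZ IH normrEsg.
rewrite (le_trans (ler_norm _))// -[leRHS]mul1r dual_fn_le//.
pose s k := Num.sg (fn F (unit_vec b k)).
apply: (@norm_unit_combination b s m) => k; rewrite /s.
by rewrite normr_sg; case: (_ != _).
Qed.

(** The norm sees the absolute values of the entries of each sequence
    independently, not their positions, so copying an entry elsewhere with any sign
    does not increase it. *)
Lemma norm_rearranged (y z : Y) :
  (forall b j, exists i, `|entry z b j| = `|entry y b i|) -> `|z| <= `|y|.
Proof.
move=> zy; apply/pair_norm_leP => b k l.
have [[i ->] [j ->]] := (zy b k, zy (~~ b) l).
by have /pair_norm_leP := lexx `|y|; exact.
Qed.

Lemma entry_sum_le y k :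
  `|entry y true k + entry y false k| <= 2 / (1 + d) * `|y|.
Proof.
rewrite (le_trans (ler_normD _ _))// mulrAC ler_pdivlMr ?addr_gt0//.
have /pair_norm_leP yy := lexx `|y|.
have := yy true k k; have := yy false k k => /=; lra.
Qed.

Lemma diagonal_dual k :
  topological_dual Y (fun y => entry y true k + entry y false k).
Proof.
apply: topological_dual_intro (entry_sum_le ^~ k) => a x y.
rewrite !entryD !entryZ.
have E (p q r s : R) : a * p + q + (a * r + s) = a * (p + r) + (q + s) by ring.
exact: E.
Qed.

Definition diagonal k : X := functional (diagonal_dual k).

Lemma norm_diagonal_le k : `|diagonal k| <= 2 / (1 + d).
Proof.
apply/norm_leP => y /= y1; rewrite (le_trans (entry_sum_le y k))//.
by rewrite ler_piMr// divr_ge0// addr_ge0// ltW.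
Qed.

(** The test vectors are [z t], [t = 1] or [t = - 1], obtained from a vector [y]
    that almost norms [F] by overwriting its [k]-th entries. *)
Lemma rough_direction F (e s : R) k : `|F| = 1 -> 0 < e -> 0 <= s ->
  (forall b, `|fn F (unit_vec b k)| <= e) ->
  2 + 2 * s - (10 + 2 * s) * e <=
    `|F + s *: diagonal k| + `|F - s *: diagonal k|.
Proof.
move=> F1 e0 s0 Fk.
have [y y1] := almost_norming F e0; rewrite F1 => Fy.
have : 1 - e < `|y|.
  rewrite (lt_le_trans Fy)// (le_trans (ler_norm _))// -[leRHS]mulr1 -F1.
  exact: dual_fn_le.
rewrite ltNge => /negP ny.
have [b [i [j bij]]] :
    exists b i j, 1 - e < `|entry y b i| + d * `|entry y (~~ b) j|.
  apply: contrapT => no; apply: ny; apply/pair_norm_leP => b i j.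
  by rewrite leNgt; apply/negP => h; apply: no; exists b, i, j.
set p := `|entry y b i| in bij; set q := `|entry y (~~ b) j| in bij.
(* The norm controls [p + d q], but the diagonal functional reads [p + q]. *)
have pq : 1 - e <= p + q.
  by rewrite (le_trans (ltW bij))// lerD2l ler_piMl// normr_ge0.
have p1 : `|p| <= 1 by rewrite /p normr_id; exact: le_trans (entry_le _ _ _) y1.
have q1 : `|q| <= 1 by rewrite /q normr_id; exact: le_trans (entry_le _ _ _) y1.
pose z (t : R) : Y := (t * p - entry y b k) *: unit_vec b k +
  ((t * q - entry y (~~ b) k) *: unit_vec (~~ b) k + y).
have entryz t b' l : entry (z t) b' l =
    if l == k then (if b' == b then t * p else t * q) else entry y b' l.
  rewrite /z !entryD !entryZ !entry_unit_vec.
  have [->|lk] := eqVneq l k; last by rewrite !andbF !mulr0 !add0r.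
  rewrite !andbT.
  by move: b b' @p @q @z {bij pq p1 q1} => [] [] p q z /=;
    rewrite ?mulr1 ?mulr0 ?add0r ?subrK.
have z1 t : `|t| = 1 -> `|z t| <= 1.
  move=> t1; rewrite (le_trans _ y1)//; apply: norm_rearranged => b' l.
  rewrite entryz; have [_|_] := eqVneq l k; last by exists l.
  have [->|b'b] := eqVneq b' b.
    by exists i; rewrite normrM t1 mul1r normr_id.
  have -> : b' = ~~ b by move: b'b; case: (b'); case: (b).
  by exists j; rewrite normrM t1 mul1r normr_id.
have diagz t : fn (diagonal k) (z t) = t * (p + q).
  rewrite -[LHS]/(entry (z t) true k + entry (z t) false k) !entryz eqxx mulrDr.
  by case: (b) => //=; rewrite addrC.
have dev t (u v : R) : `|t| = 1 -> `|u| <= 1 -> `|v| <= 1 -> `|t * u - v| <= 2.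
  move=> t1 u1 v1; rewrite (le_trans (ler_normB _ _))//.
  by rewrite normrM t1 mul1r -[2]/(1 + 1) lerD.
(* Each overwritten entry changes by at most 2, at a point where [F] is at most
   [e]: two changes cost [4 * e], and [F y] itself misses 1 by [e]. *)
have Fz t : `|t| = 1 -> 1 - 5 * e <= fn F (z t).
  move=> t1; rewrite /z !dual_fnD !dual_fnZ.
  have := lerD (ler_pM (normr_ge0 _) (normr_ge0 _)
      (dev t p _ t1 p1 (le_trans (entry_le y b k) y1)) (Fk b))
    (ler_pM (normr_ge0 _) (normr_ge0 _)
      (dev t q _ t1 q1 (le_trans (entry_le y (~~ b) k) y1)) (Fk (~~ b))).
  rewrite -!normrM; set u := _ * _; set v := _ * fn F _ => uv.
  have := ler_norm (- u); have := ler_norm (- v); rewrite !normrN.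
  by move: uv Fy; lra.
have fn_le_norm G t : `|t| = 1 -> fn G (z t) <= `|G|.
  by move=> t1; rewrite (le_trans (ler_norm _))// -[leRHS]mul1r dual_fn_le// z1.
have h1 := fn_le_norm (F + s *: diagonal k) 1 (normr1 _).
have h2 := fn_le_norm (F - s *: diagonal k) (-1) (normrN1 _).
move: h1 h2; rewrite !fnD fnN !fnZ !diagz => h1 h2.
have := Fz 1 (normr1 _); have := Fz (-1) (normrN1 _).
have := ler_wpM2l s0 pq; move: h1 h2; lra.
Qed.

Lemma norm_diagonal_ge1 k : 1 <= `|diagonal k|.
Proof.
have := dual_fn_le (diagonal k) (norm_unit_vec true k); rewrite mul1r.
rewrite -[fn _ _]/(entry _ true k + entry _ false k) !entry_unit_vec !eqxx /=.
by rewrite addr0 normr1.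
Qed.

(** The error term of [rough_direction] is linear in [e]; since the direction
    [y = s D_k] has norm at least [s] whatever [k] is, [e] can be fixed before
    [k]. *)
Lemma dual_average_rough : average_rough (1 + d) X.
Proof.
move=> n x n0 x1; apply: le_ereal_inf_tmp => _ [V /nbhs_ballP[r /= r0 rV] <-].
apply/lee_addgt0Pr => eta eta0.
pose s := r / 4.
have s0 : 0 < s by rewrite divr_gt0.
pose e := eta * s / (10 + 2 * s).
have c0 : 0 < 10 + 2 * s by rewrite addr_gt0// mulr_gt0.
have e0 : 0 < e by rewrite divr_gt0// mulr_gt0.
have [k xk] : exists k, forall i b, `|fn (x i) (unit_vec b k)| <= e.
  have : \forall k \near \oo, forall i b, `|fn (x i) (unit_vec b k)| <= e.
    apply: filter_forall => i; apply: filter_forall => b.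
    by apply: cvgr0_norm_le e0; exact: functional_unit_vec_cvg0.
  exact: filter_ex.
pose y := s *: diagonal k.
have ny : `|y| = s * `|diagonal k| by rewrite normrZ gtr0_norm.
have d10 : 0 < 1 + d by rewrite addr_gt0.
have sy : s <= `|y| by rewrite ny ler_peMr ?norm_diagonal_ge1// ltW.
have ys : (1 + d) * `|y| <= 2 * s.
  rewrite ny mulrCA mulrC; apply: ler_wpM2r; first exact: ltW.
  by rewrite mulrC -ler_pdivlMr// norm_diagonal_le.
have y0 : 0 < `|y| by exact: lt_le_trans sy.
have Vy : V y.
  apply: rV; last by rewrite -normr_gt0.
  rewrite -ball_normE /= sub0r normrN (@le_lt_trans _ _ (2 * s))//.
    by rewrite (le_trans _ ys)// ler_peMl// lerDl ltW.
  by rewrite /s; move: r0; lra.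
have quotient_ge : 1 + d - eta <= roughness_quotient x y.
  rewrite /roughness_quotient ler_pdivlMl ?ltr0n//.
  rewrite mulr_natl -[n in leLHS]card_ord -sumr_const ler_sum// => i _.
  rewrite ler_pdivlMr//.
  have := rough_direction (x1 i) e0 (ltW s0) (xk i).
  have -> : (10 + 2 * s) * e = eta * s by rewrite mulrC /e divfK ?gt_eqF.
  have := ler_wpM2l (ltW eta0) sy; move: ys.
  rewrite -/y mulrBl; lra.
rewrite (@le_trans _ _ ((roughness_quotient x y)%:E + eta%:E)%E)//.
  by rewrite -EFinD lee_fin -lerBlDr.
by rewrite leeD2r// ereal_sup_ubound//; exists y.
Qed.

Lemma norm_part_le b y : `|part b y| <= `|y|.
Proof. by apply/norm_part_leP => // k; exact: entry_le. Qed.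

Lemma part_dual b H : topological_dual Y (fun y => fn H (part b y)).
Proof.
apply: (@topological_dual_intro _ _ _ `|H|) => [a x y|y].
  by rewrite partZD dual_fnZD.
by rewrite mulrC dual_fn_le// norm_part_le.
Qed.

Definition part_functional b H : X := functional (part_dual b H).

Lemma part_functional_le b H y :
  `|fn H (part b y)| <= `|part b y| * `|part_functional b H|.
Proof. by have := fn_le (part_functional b H) (part b y); rewrite /= part_idem. Qed.

Lemma norm_part_functional_le b H : `|part_functional b H| <= `|H|.
Proof.
apply/norm_leP => y /= y1; rewrite -[leRHS]mul1r dual_fn_le//.
exact: le_trans (norm_part_le b y) y1.
Qed.

Lemma part_functionalN b H :
  `|part_functional b (- H)| = `|part_functional b H|.
Proof. by rewrite -[RHS]normrN; congr `|_|; exact: val_inj. Qed.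

(** Vectors [y] and [z] almost norming the two parts of [H] can be glued together
    into one vector of norm at most [1 + d], on which [H] takes the sum of both
    values. *)
Lemma norm_part_functional_sum H :
  `|part_functional true H| + `|part_functional false H| <= (1 + d) * `|H|.
Proof.
rewrite -lerBrDr; apply/norm_leP => y /= y1; rewrite lerBrDl -lerBrDr.
apply/norm_leP => z /= z1; rewrite lerBrDr.
pose w := Num.sg (fn H (part false z)) *: part false z +
  Num.sg (fn H (part true y)) *: part true y.
have -> : `|fn H (part false z)| + `|fn H (part true y)| = fn H w.
  by rewrite dual_fnD !dual_fnZ -!normrEsg.
rewrite (le_trans (ler_norm _))// dual_fn_le//.
have sg1 (u v : R) : `|v| <= 1 -> `|Num.sg u * v| <= 1.
  by move=> v1; rewrite normrM normr_sg; case: (_ != _); rewrite ?mul1r ?mul0r.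
apply/pair_norm_leP => b k l.
have w1 c j : `|entry w c j| <= 1.
  rewrite /w entryD !entryZ !entry_part.
  by case: c; rewrite /= mulr0 ?addr0 ?add0r sg1// (le_trans (entry_le _ _ _)).
by rewrite lerD// -[leRHS]mulr1 ler_wpM2l// ltW.
Qed.

Lemma first_entry_dual b : topological_dual Y (fun y => entry y b 0).
Proof.
apply: (@topological_dual_intro _ _ _ 1) => [a x y|y] //.
by rewrite mul1r entry_le.
Qed.

Definition first_entry b : X := functional (first_entry_dual b).

Lemma norm_first_entry b : `|first_entry b| = 1.
Proof.
apply/eqP; rewrite eq_le; apply/andP; split.
  by apply/norm_leP => y /=; apply: le_trans; exact: entry_le.
have := dual_fn_le (first_entry b) (norm_unit_vec b 0); rewrite mul1r.
by rewrite -[fn _ _]/(entry _ b 0) entry_unit_vec !eqxx normr1.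
Qed.

(** The other part of [H] is at most [d] in norm, and [d] is the weight with which
    the other sequence already enters the norm of [y]: it adds nothing to the
    first order term. *)
Lemma norm_first_entry_add b H : `|H| <= d ->
  `|first_entry b + H| <= 1 + `|part_functional b H|.
Proof.
move=> Hd; apply/norm_leP => y y1; rewrite fnD.
rewrite -[fn (first_entry b) y]/(entry y b 0) (part_split b y) dual_fnD.
rewrite -(part_split b y).
have h1 := part_functional_le b H y; have h2 := part_functional_le (~~ b) H y.
have h3 := le_trans (norm_part_functional_le (~~ b) H) Hd.
have h4 : `|entry y b 0| <= `|part b y|.
  by have := lexx `|part b y|; move/(norm_part_leP d1); exact.
have h5 := le_trans (norm_part_sum_le d1 b y) y1.
rewrite (le_trans (ler_normD _ _))//.
rewrite (le_trans (lerD (lexx _) (ler_normD _ _)))//.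
have h6 := le_trans h2 (ler_wpM2l (normr_ge0 _) h3).
have := ler_wpM2l (normr_ge0 (part_functional b H)) h5.
have : 0 <= `|part_functional b H| * (d * `|part (~~ b) y|).
  by rewrite !mulr_ge0// ltW.
nra.
Qed.

Lemma dual_not_average_rough (gamma : R) :
  1 + d < gamma -> ~ average_rough gamma X.
Proof.
move=> dgamma rough; pose x (i : 'I_2) : X := first_entry (i == ord0).
have := rough 2 x isT (fun i => norm_first_entry _).
apply/negP; rewrite -ltNge; apply: (@le_lt_trans _ _ (1 + d)%:E).
  pose V := [set H : X | H != 0 /\ `|H| <= d].
  pose Q (y : X) := (roughness_quotient x y)%:E.
  apply: (@le_trans _ _ (ereal_sup (Q @` V))).
    apply: ereal_inf_lbound; exists V => //.
    apply/nbhs_ballP; exists d => //= H; rewrite -ball_normE /= sub0r normrN.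
    by move=> /ltW Hd H0.
  apply: ge_ereal_sup => _ [H [H0 Hd] <-]; rewrite lee_fin.
  have nH : 0 < `|H| by rewrite normr_gt0.
  have NHd : `|- H| <= d by rewrite normrN.
  rewrite /roughness_quotient ler_pdivrMl// big_ord_recl big_ord1 /x /=.
  rewrite -mulrDl ler_pdivrMr//.
  have a1 := norm_first_entry_add true Hd.
  have a2 := norm_first_entry_add false Hd.
  have := norm_first_entry_add true NHd; rewrite part_functionalN => a3.
  have := norm_first_entry_add false NHd; rewrite part_functionalN => a4.
  have E (p q r s u v c : R) : p <= 1 + u -> r <= 1 + v -> q <= 1 + u ->
    s <= 1 + v -> u + v <= c -> p + q - 2 + (r + s - 2) <= 2 * c by lra.
  by rewrite -mulrA; exact: E a1 a2 a3 a4 (norm_part_functional_sum H).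
by rewrite lte_fin.
Qed.

End roughness.

(** * The example *)

Unset Implicit Arguments.

Theorem theorem2p8 (R : realType) (delta : R) (hdelta : 1 < delta <= 2) :
  exists X : completeNormedModType R,
    [/\ is_dual_space X,
        average_rough delta X &
        forall gamma : R, delta < gamma -> ~ average_rough gamma X].
Proof.
have /andP[delta_gt1 delta_le2] := hdelta.
have d0 : 0 < delta - 1 by rewrite subr_gt0.
have d1 : delta - 1 <= 1 by lra.
have dE : 1 + (delta - 1) = delta by rewrite addrC subrK.
exists (sup_space (dual_family (sup_space (pair_family d0)))); split.
- exact: dual_is_dual_space.
- by have := dual_average_rough (d0 := d0) d1; rewrite dE.
- move=> gamma dgamma; apply: dual_not_average_rough => //.
  by rewrite dE.
Qed.
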